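(* For each integer $r>2$, let $n'_r$ be the least positive integer such that $C_r(\mathcal{N}_{n'_r})$ is reducible. Then $n'_3$ is in the interval $[4,29]$, and $n'_r=4$ for all $r>3$.
   Context: $k$ is an algebraically closed field, $\mathcal{N}_n$ is the variety of nilpotent $n\times n$ matrices over $k$, a closed subvariety of the affine space $\mathfrak{gl}_n$ of $n\times n$ matrices. $C_r(\mathcal{N}_n)=\{(v_1,\ldots,v_r)\in (\mathcal{N}_n)^r : [v_i,v_j]=0 \text{ for all } i,j\}$, with the Zariski topology. Reducible means not irreducible as a topological space. The existence of $n'_r$ is part of the assertion. *)

(* Defs.v *)
From HB Require Import structures.
From mathcomp Require Import all_boot all_order all_algebra.
From mathcomp Require Import boolp classical_sets topology_structure.
(* the notations of mpoly clash with those of MathComp-Analysis *)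
From mathcomp Require Import -(notations) mpoly.
Set Implicit Arguments.
Unset Strict Implicit.
Unset Printing Implicit Defensive.
Import GRing.Theory.
Local Open Scope classical_set_scope.
Local Open Scope ring_scope.

(* A copy of the type of r-tuples of n x n matrices, to carry the Zariski
   topology of the affine space (gl_n)^r. *)
Definition mx_tuple (k : closedFieldType) (r n : nat) : Type :=
  r.-tuple 'M[k]_n.

HB.instance Definition _ (k : closedFieldType) (r n : nat) :=
  Choice.copy (mx_tuple k r n) (r.-tuple 'M[k]_n).

Section Zariski.
Variables (k : closedFieldType) (r n : nat).

Definition coord_index : finType := ('I_r * ('I_n * 'I_n))%type.

Definition coord (v : mx_tuple k r n) (c : 'I_#|coord_index|) : k :=
  let: (l, (i, j)) := enum_val c in tnth v l i j.

Definition zero_locus (S : set (mpoly #|coord_index| k)) :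
    set (mx_tuple k r n) :=
  [set v | forall p, S p -> meval (coord v) p = 0].

Definition zariski_open (U : set (mx_tuple k r n)) : Prop :=
  exists S, U = ~` zero_locus S.

Lemma zariski_openT : zariski_open setT.
Proof.
exists [set 1]; rewrite -[LHS]setCK setCT; congr (~` _).
apply/seteqP; split=> // v /(_ 1 erefl).
by rewrite meval1 => /eqP; rewrite oner_eq0.
Qed.

Lemma zariski_openI : setI_closed zariski_open.
Proof.
move=> _ _ [S ->] [T ->].
exists [set q | exists p1 p2, [/\ S p1, T p2 & q = p1 * p2]].
rewrite -setCU; congr (~` _); apply/seteqP; split=> v.
  move=> [Sv|Tv] _ [p1 [p2 [Sp1 Tp2 ->]]]; rewrite mevalM.
    by rewrite (Sv _ Sp1) mul0r.
  by rewrite (Tv _ Tp2) mulr0.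
move=> STv; have [Sv|] := pselect (zero_locus S v); first by left.
move=> /existsNP[p1 /not_implyP[Sp1 p1v]]; right=> p2 Tp2.
have : meval (coord v) (p1 * p2) = 0 by apply: STv; exists p1, p2.
by rewrite mevalM => /eqP; rewrite mulf_eq0 => /orP[/eqP //|/eqP].
Qed.

Lemma zariski_open_bigU (I : Type) (U : I -> set (mx_tuple k r n)) :
  (forall i, zariski_open (U i)) -> zariski_open (\bigcup_i U i).
Proof.
move=> /choice[S US]; exists (\bigcup_i S i).
apply/seteqP; split=> v.
  by move=> [i _]; rewrite US => Siv Sv; apply: Siv => p Sp; apply: Sv; exists i.
move=> /existsNP[p /not_implyP[[i _ Sp] pv]].
by exists i => //; rewrite US => /(_ _ Sp).
Qed.

HB.instance Definition _ := isOpenTopological.Build (mx_tuple k r n)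
  zariski_openT zariski_openI zariski_open_bigU.

Lemma zariski_closedE (A : set (mx_tuple k r n)) :
  closed A <-> exists S, A = zero_locus S.
Proof.
rewrite -openC; split=> [[S AS]|[S ->]]; last by exists S.
by exists S; rewrite -[A]setCK AS setCK.
Qed.

End Zariski.

(* A is irreducible for the topology induced by T: it is nonempty and is not
   the union of two proper relatively closed subsets. *)
Definition irreducible (T : topologicalType) (A : set T) : Prop :=
  A !=set0 /\
  forall B C : set T,
    (exists2 Z, closed Z & B = A `&` Z) ->
    (exists2 Z, closed Z & C = A `&` Z) ->
    A = B `|` C -> B = A \/ C = A.

Definition reducible (T : topologicalType) (A : set T) : Prop :=
  ~ irreducible A.

Definition nilpotent_mx (k : closedFieldType) (n : nat) : set 'M[k]_n :=
  [set A | exists m : nat, A ^+ m = 0].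

Definition commuting_nilpotent (k : closedFieldType) (r n : nat) :
    set (mx_tuple k r n) :=
  [set v | (forall i, nilpotent_mx (tnth v i)) /\
           (forall i j, tnth v i *m tnth v j - tnth v j *m tnth v i = 0)].

Definition least_reducible_size (k : closedFieldType) (r n : nat) : Prop :=
  [/\ (0 < n)%N,
      reducible (@commuting_nilpotent k r n) &
      forall m, (0 < m)%N -> reducible (@commuting_nilpotent k r m) ->
        (n <= m)%N].

(* Main.v *)
Require Import Defs.
From mathcomp Require Import all_boot all_order all_algebra.
From mathcomp Require Import zify ring.
From mathcomp Require Import boolp classical_sets topology_structure.
From mathcomp Require Import -(notations) mpoly.
Set Implicit Arguments.
Unset Strict Implicit.
Unset Printing Implicit Defensive.
Import GRing.Theory.
Local Open Scope ring_scope.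

(* If the first matrix A of a commuting nilpotent tuple is regular, all the
   others are polynomials in A.  Reducibility follows from any polynomial
   condition that holds on these tuples but not on the whole variety.

   Sizes up to 3 (irreducible): commuting nilpotent matrices are simultaneously
   strictly triangularizable, and commuting strictly triangular 3 x 3 matrices
   have proportional entries (0,1), (1,2).  So the variety is the image of an
   affine space under (g, T) |-> g T adj(g), and any two of its points lie on a
   polynomial curve contained in it.

   Size 4, r > 3: the commutant of a regular A has dimension 4, whereas 1 and
   four matrix units E_ij with i < 2 <= j are linearly independent.

   Size 26, r = 3: for a monomial t in three variables, apply t(A, B, C) to the
   first basis vector; the 26 x 26 determinants of such vectors are Plucker
   coordinates of the ideal annihilating that vector.  If A is regular they are,
   up to a common factor, polynomials in the 2 * 26 coefficients of B and C as
   polynomials in A.  Iarrobino's algebras with Hilbert function (1,3,6,10,6)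
   have 9 * 6 = 54 > 52 independent parameters among these ratios, so they
   violate some homogeneous relation valid on regular triples. *)

(** * Polynomial functions on tuples of matrices *)

Definition polynomial_fun (k : closedFieldType) r n (f : mx_tuple k r n -> k) :=
  exists p, forall v, f v = meval (Defs.coord v) p.

Definition polynomial_mxfun (k : closedFieldType) r n a b
    (F : mx_tuple k r n -> 'M[k]_(a, b)) :=
  forall i j, polynomial_fun (fun v => F v i j).

Lemma polynomial_fun_cst (k : closedFieldType) r n (c : k) :
  polynomial_fun (fun _ : mx_tuple k r n => c).
Proof. by exists (mpolyC _ c) => v; rewrite mevalC. Qed.

Lemma polynomial_funM (k : closedFieldType) r n (f g : mx_tuple k r n -> k) :
  polynomial_fun f -> polynomial_fun g -> polynomial_fun (fun v => f v * g v).
Proof. by move=> [p fp] [q gq]; exists (p * q) => v; rewrite mevalM fp gq. Qed.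

Lemma polynomial_fun_sum (k : closedFieldType) r n (I : Type) (s : seq I)
    (f : I -> mx_tuple k r n -> k) :
  (forall i, polynomial_fun (f i)) ->
  polynomial_fun (fun v => \sum_(i <- s) f i v).
Proof.
move=> /choice[p fp]; exists (\sum_(i <- s) p i) => v.
by rewrite raddf_sum; apply: eq_bigr => i _; rewrite fp.
Qed.

Lemma polynomial_fun_prod (k : closedFieldType) r n (I : Type) (s : seq I)
    (f : I -> mx_tuple k r n -> k) :
  (forall i, polynomial_fun (f i)) ->
  polynomial_fun (fun v => \prod_(i <- s) f i v).
Proof.
move=> /choice[p fp]; exists (\prod_(i <- s) p i) => v.
by rewrite rmorph_prod; apply: eq_bigr => i _; rewrite fp.
Qed.

Lemma polynomial_funX (k : closedFieldType) r n (f : mx_tuple k r n -> k) m :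
  polynomial_fun f -> polynomial_fun (fun v => f v ^+ m).
Proof. by move=> [p fp]; exists (p ^+ m) => v; rewrite rmorphXn /= fp. Qed.

Lemma polynomial_mxfun_cst (k : closedFieldType) r n a b (M : 'M[k]_(a, b)) :
  polynomial_mxfun (fun _ : mx_tuple k r n => M).
Proof. by move=> i j; exact: polynomial_fun_cst. Qed.

Lemma polynomial_mxfun_tnth (k : closedFieldType) r n (l : 'I_r) :
  polynomial_mxfun (fun v : mx_tuple k r n => tnth v l).
Proof.
move=> i j; pose c : coord_index r n := (l, (i, j)).
exists (mpolyX _ (mnm1 (enum_rank c))).
by move=> v; rewrite mevalXU /Defs.coord enum_rankK.
Qed.

Lemma polynomial_mxfunM (k : closedFieldType) r n a b c
    (F : mx_tuple k r n -> 'M[k]_(a, b)) (G : mx_tuple k r n -> 'M[k]_(b, c)) :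
  polynomial_mxfun F -> polynomial_mxfun G ->
  polynomial_mxfun (fun v => F v *m G v).
Proof.
move=> pF pG i j.
have [p pE] : polynomial_fun (fun v => \sum_l F v i l * G v l j).
  by apply: polynomial_fun_sum => l; apply: polynomial_funM.
by exists p => v; rewrite mxE.
Qed.

Lemma polynomial_mxfunX (k : closedFieldType) r n a
    (F : mx_tuple k r n -> 'M[k]_a) m :
  polynomial_mxfun F -> polynomial_mxfun (fun v => F v ^+ m).
Proof.
move=> pF; elim: m => [|m IHm]; first exact: polynomial_mxfun_cst.
have eqF : (fun v => F v ^+ m.+1) = (fun v => F v *m F v ^+ m).
  by apply: funext => v; rewrite exprS.
by rewrite eqF; apply: polynomial_mxfunM.
Qed.

Lemma polynomial_fun_det (k : closedFieldType) r n a
    (F : mx_tuple k r n -> 'M[k]_a) :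
  polynomial_mxfun F -> polynomial_fun (fun v => \det (F v)).
Proof.
move=> pF; apply: polynomial_fun_sum => s.
apply: polynomial_funM; first exact: polynomial_fun_cst.
by apply: polynomial_fun_prod => i.
Qed.

(** * Criteria for reducibility and irreducibility *)

(** The product of [f] and [g] vanishes on [A], so their zero loci cover [A]; the points [a] and [b]
    show that both pieces are proper. *)
Lemma reducible_of_zero_divisors (k : closedFieldType) r n
    (A : set (mx_tuple k r n)) (f g : mx_tuple k r n -> k) a b :
  polynomial_fun f -> polynomial_fun g ->
  (forall v, A v -> f v != 0 -> g v = 0) ->
  A a -> f a != 0 -> A b -> g b != 0 -> reducible A.
Proof.
move=> [p fp] [q gq] fg Aa fa Ab gb [_ irrA].
have closedZ (s : mpoly _ k) : closed (@zero_locus k r n [set s]%classic).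
  by apply/zariski_closedE; exists [set s]%classic.
have relZ (s : mpoly _ k) : exists2 Z, closed Z &
    (A `&` @zero_locus k r n [set s])%classic = (A `&` Z)%classic.
  by exists (@zero_locus k r n [set s]%classic).
have AE : A = (A `&` zero_locus [set p] `|` A `&` zero_locus [set q])%classic.
  apply/seteqP; split=> [v Av|v [][]//].
  have [fv|fv] := eqVneq (f v) 0; [left|right]; split=> // _ /= ->.
    by rewrite -fp.
  by rewrite -gq fg.
have [E|E] := irrA _ _ (relZ p) (relZ q) AE.
- by move: Aa; rewrite -E => -[_ /(_ p erefl)]; rewrite -fp; apply/eqP.
- by move: Ab; rewrite -E => -[_ /(_ q erefl)]; rewrite -gq; apply/eqP.
Qed.

Definition horner_tuple (k : closedFieldType) r n
    (V : 'I_r -> 'M[{poly k}]_n) (t : k) : mx_tuple k r n :=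
  [tuple map_mx (horner_eval t) (V l) | l < r].

Lemma horner_coord (k : closedFieldType) r n (V : 'I_r -> 'M[{poly k}]_n)
    (p : mpoly #|coord_index r n| k) :
  exists P : {poly k}, forall t,
    meval (Defs.coord (horner_tuple V t)) p = P.[t].
Proof.
pose W (c : 'I_#|coord_index r n|) :=
  let: (l, (i, j)) := enum_val c : coord_index r n in V l i j.
exists (\sum_(m <- msupp p) (mcoeff m p) *: \prod_c (W c) ^+ m c) => t.
rewrite mevalE horner_sum; apply: eq_bigr => m _.
rewrite hornerZ horner_prod; congr (_ * _); apply: eq_bigr => c _.
rewrite horner_exp /Defs.coord /W; case: (enum_val c) => l [i j].
by rewrite tnth_mktuple !mxE.
Qed.

(** If two proper closed pieces covered [A], polynomials cutting them out would be nonzero at [a]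
    and [b] respectively. On a curve from [a] to [b] they become nonzero univariate polynomials,
    whose product has a non-root; the curve point there lies in neither piece. *)
Lemma irreducible_of_curves (k : closedFieldType) r n
    (A : set (mx_tuple k r n)) :
  (A !=set0)%classic ->
  (forall a b, A a -> A b -> exists V : 'I_r -> 'M[{poly k}]_n,
    [/\ forall t, A (horner_tuple V t), horner_tuple V 0 = a
      & horner_tuple V 1 = b]) ->
  irreducible A.
Proof.
move=> A0 curves; split=> // B C [Z1 cZ1 ->] [Z2 cZ2 ->] AE.
have [S1 Z1E] := (zariski_closedE Z1).1 cZ1.
have [S2 Z2E] := (zariski_closedE Z2).1 cZ2.
have [AZ1|] := pselect (A `<=` Z1)%classic; first by left; apply/setIidl.
have [AZ2|] := pselect (A `<=` Z2)%classic; first by right; apply/setIidl.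
rewrite Z1E Z2E => /existsNP[b /not_implyP[Ab /existsNP[q /not_implyP[Sq qb]]]].
move=> /existsNP[a /not_implyP[Aa /existsNP[p /not_implyP[Sp pa]]]].
have [V [AV Va Vb]] := curves a b Aa Ab.
have [P PE] := horner_coord V p; have [Q QE] := horner_coord V q.
have P0 : P != 0 by apply/eqP => P0; apply: pa; rewrite -Va PE P0 horner0.
have Q0 : Q != 0 by apply/eqP => Q0; apply: qb; rewrite -Vb QE Q0 horner0.
have /closed_nonrootP[t] : P * Q != 0 by rewrite mulf_neq0.
rewrite rootM negb_or => /andP[/rootP Pt /rootP Qt]; exfalso.
have := AV t; rewrite {1}AE Z1E Z2E => -[[_ /(_ p Sp)]|[_ /(_ q Sq)]].
  by rewrite PE.
by rewrite QE.
Qed.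

(** * Regular nilpotent matrices and their commutants *)

(** The minimal polynomial divides ['X^N], so it is some ['X^j]; it also divides the characteristic
    polynomial, so [j <= n.+1]. *)
Lemma nilpotent_mx_exp (F : fieldType) n (A : 'M[F]_n.+1) N :
  A ^+ N = 0 -> A ^+ n.+1 = 0.
Proof.
move=> AN; have : mxminpoly A %| ('X - 0%:P) ^+ N.
  by rewrite dvd_mxminpoly rmorphXn rmorphB /= horner_mx_X horner_mx_C
    raddf0 subr0 AN.
move=> /dvdp_exp_XsubCP[j lejN]; rewrite subr0.
rewrite eqp_monic ?mxminpoly_monic ?monicXn // => /eqP minA.
have lejn : (j <= n.+1)%N.
  rewrite -ltnS -(size_polyXn F) -minA -(size_char_poly A).
  by rewrite dvdp_leq ?mxminpoly_dvd_char // monic_neq0 ?char_poly_monic.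
have := mx_root_minpoly A; rewrite minA rmorphXn /= horner_mx_X => Aj.
have -> : A ^+ n.+1 = A ^+ (n.+1 - j) * A ^+ j by rewrite -exprD subnK.
by rewrite Aj mulr0.
Qed.

(** The rows are e_0 A^i, where e_0 is the first basis row vector; the matrix is invertible exactly
    when e_0 is cyclic for the right action of A. *)
Definition krylov_mx (F : fieldType) n (A : 'M[F]_n.+1) : 'M[F]_n.+1 :=
  \matrix_(i, j) (A ^+ i) 0 j.

(** The entry condition is a polynomial form of regularity. Pairing the rows e_0 A^i with the last
    columns of A^(n-j) gives entries of A^(i+n-j): these vanish for i > j and are the given nonzero
    entry on the diagonal. *)
Lemma krylov_mx_unit (F : fieldType) n (A : 'M[F]_n.+1) :
  A ^+ n.+1 = 0 -> (A ^+ n) 0 ord_max != 0 -> krylov_mx A \in unitmx.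
Proof.
move=> An An0; pose Z : 'M[F]_n.+1 := \matrix_(i, j) (A ^+ (n - j)) i ord_max.
have WZ i j : (krylov_mx A *m Z) i j = (A ^+ (i + (n - j))) 0 ord_max.
  by rewrite exprD mxE [RHS]mxE; apply: eq_bigr => l _; rewrite !mxE.
have : \det (krylov_mx A *m Z) != 0.
  rewrite -det_tr det_trig.
    apply/prodf_neq0 => i _; rewrite mxE WZ.
    by rewrite subnKC // -ltnS.
  apply/is_trig_mxP => i j ltij; rewrite mxE WZ.
  have -> : (j + (n - i) = (j + (n - i) - n.+1) + n.+1)%N.
    by rewrite subnK //; lia.
  by rewrite exprD An mulr0 mxE.
by rewrite det_mulmx mulf_eq0 negb_or unitmxE unitfE => /andP[].
Qed.

Lemma row0_horner_mx (F : fieldType) n (A : 'M[F]_n.+1) (f : {poly F}) :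
  A ^+ n.+1 = 0 ->
  row 0 (horner_mx A f) = poly_rV f *m krylov_mx A.
Proof.
move=> An; rewrite -[in LHS](poly_take_drop n.+1 f) rmorphD rmorphM rmorphXn /=.
rewrite horner_mx_X An mulr0 addr0 /take_poly poly_def.
apply/rowP => j; rewrite raddf_sum mxE summxE [RHS]mxE.
by apply: eq_bigr => i _; rewrite /= horner_mxZ rmorphXn /= horner_mx_X !mxE.
Qed.

(** Since e_0 is cyclic, a matrix commuting with [A] is determined by its first row; [p] holds the
    coordinates of the first row of [B] in the Krylov basis. *)
Lemma commutant_regular_nilpotent (F : fieldType) n (A B : 'M[F]_n.+1) :
  A ^+ n.+1 = 0 -> (A ^+ n) 0 ord_max != 0 -> comm_mx B A ->
  exists p : 'rV[F]_n.+1, B = horner_mx A (rVpoly p).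
Proof.
move=> An An0 BA; have KU := krylov_mx_unit An An0.
pose p : 'rV_n.+1 := row 0 B *m invmx (krylov_mx A); exists p.
apply: (can_inj (mulKmx KU)); apply/row_matrixP => i.
have rowK (C : 'M_n.+1) : comm_mx A C ->
    row i (krylov_mx A *m C) = row 0 C *m A ^+ i.
  move=> AC; have -> : row i (krylov_mx A *m C) = row 0 (A ^+ i *m C).
    by rewrite !row_mul; congr (_ *m _); apply/rowP => j; rewrite !mxE.
  have -> : A ^+ i *m C = C *m A ^+ i by apply/esym/commrX/commr_sym.
  by rewrite row_mul.
rewrite !rowK //; last exact: comm_mx_horner.
by rewrite row0_horner_mx // rVpolyK mulmxKV.
Qed.

Definition jordan_mx (F : fieldType) n : 'M[F]_n :=
  \matrix_(i, j) (j == i.+1 :> nat)%:R.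

Lemma jordan_mxX (F : fieldType) n m (i j : 'I_n.+1) :
  (jordan_mx F n.+1 ^+ m) i j = (j == i + m :> nat)%N%:R.
Proof.
elim: m i => [|m IHm] i.
  by rewrite expr0 mxE addn0 eq_sym.
rewrite exprS mxE; under eq_bigr => l _ do rewrite IHm mxE.
have [lt_in|le_ni] := ltnP i.+1 n.+1.
  rewrite (bigD1 (Ordinal lt_in)) //= eqxx mul1r big1 ?addr0 ?addSnnS //.
  by move=> l; rewrite -val_eqE /= => /negbTE->; rewrite mul0r.
rewrite big1 => [|l _]; last first.
  by rewrite ltn_eqF ?mul0r // (leq_trans (ltn_ord l)).
rewrite ltn_eqF // (leq_trans (ltn_ord j)) // addnS.
by rewrite (leq_trans le_ni) // ltnS leq_addr.
Qed.

Lemma jordan_mx_nilpotent (F : fieldType) n : jordan_mx F n.+1 ^+ n.+1 = 0.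
Proof.
apply/matrixP => i j; rewrite jordan_mxX mxE ltn_eqF //.
by rewrite (leq_trans (ltn_ord j)) // leq_addl.
Qed.

Lemma commuting_nilpotent_nth (k : closedFieldType) r n
    (V : 'I_r -> 'M[k]_n) m :
  (forall i, V i ^+ m = 0) -> (forall i j, V i *m V j = V j *m V i) ->
  commuting_nilpotent [tuple V i | i < r].
Proof.
move=> nilV commV; split=> [i|i j]; rewrite !tnth_mktuple.
  by exists m; apply: nilV.
by rewrite commV subrr.
Qed.

(** One Jordan block and zeros elsewhere: the regularity condition does not fail identically on the
    variety. *)
Lemma regular_tuple (k : closedFieldType) r n (l : 'I_r) :
  exists2 v : mx_tuple k r n.+1, commuting_nilpotent v &
    (tnth v l ^+ n) 0 ord_max != 0.
Proof.
exists [tuple (if i == l then jordan_mx k n.+1 else 0) | i < r].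
  apply: (@commuting_nilpotent_nth _ _ _ _ n.+1) => [i|i j].
    by case: eqP => _; rewrite ?jordan_mx_nilpotent ?expr0n.
  by case: eqP => _; case: eqP => _; rewrite ?mulmx0 ?mul0mx.
by rewrite tnth_mktuple eqxx jordan_mxX eqxx oner_neq0.
Qed.

Lemma commuting_nilpotent_comm (k : closedFieldType) r n
    (v : mx_tuple k r n) i j :
  commuting_nilpotent v -> comm_mx (tnth v i) (tnth v j).
Proof. by case=> _ commv; apply/eqP; rewrite -subr_eq0 commv. Qed.

Lemma commuting_nilpotent_exp (k : closedFieldType) r n
    (v : mx_tuple k r n.+1) i :
  commuting_nilpotent v -> tnth v i ^+ n.+1 = 0.
Proof. by case=> nilv _; have [m] := nilv i; apply: nilpotent_mx_exp. Qed.

(** * Reducibility in size 4 for r > 3 *)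

(** All [B l] lie in the span of [n.+1] powers of [A], so the matrix of their entries at any [m]
    positions factors through dimension [n.+1 < m]. *)
Lemma det_commutant_eq0 (F : fieldType) n m (A : 'M[F]_n.+1)
    (B : 'I_m -> 'M_n.+1) (c : 'I_m -> 'I_n.+1 * 'I_n.+1) :
  (n.+1 < m)%N -> A ^+ n.+1 = 0 -> (A ^+ n) 0 ord_max != 0 ->
  (forall l, comm_mx (B l) A) ->
  \det (\matrix_(l, j) B l (c j).1 (c j).2) = 0.
Proof.
move=> ltnm An An0 commB.
have /choice[p Bp] := fun l => commutant_regular_nilpotent An An0 (commB l).
have -> : \matrix_(l, j) B l (c j).1 (c j).2 =
    (\matrix_l p l) *m (\matrix_(i < n.+1, j < m) (A ^+ i) (c j).1 (c j).2).
  apply/matrixP => l j; rewrite !mxE Bp [rVpoly _]poly_def raddf_sum summxE.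
  apply: eq_bigr => i _.
  by rewrite valK /= horner_mxZ rmorphXn /= horner_mx_X !mxE.
apply/eqP; apply/negP => /negP; rewrite -unitfE -unitmxE -row_full_unit.
rewrite -col_leq_rank; apply/negP; rewrite -ltnNge.
rewrite (leq_ltn_trans (mxrankM_maxl _ _)) //.
by rewrite (leq_ltn_trans (rank_leq_col _)).
Qed.

Lemma reducible_size4 (k : closedFieldType) r :
  (3 < r)%N -> reducible (@commuting_nilpotent k r 4).
Proof.
move=> lt3r.
pose l i : 'I_r := insubd (Ordinal lt3r) i.
have lE i : (i < 4)%N -> l i = i :> nat.
  by move=> lti; rewrite /l val_insubd (leq_trans lti lt3r).
pose B (v : mx_tuple k r 4) (i : 'I_5) : 'M[k]_4 :=
  if i == 0 then 1%:M else tnth v (l i.-1).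
(* Position (0,0) detects the identity; at the other four, those of the matrix units with i < 2 <=
   j, the identity vanishes. *)
pose c (j : nat) : 'I_4 * 'I_4 :=
  nth (0, 0) [:: (0, 0); (0, inord 2); (0, inord 3);
    (inord 1, inord 2); (inord 1, inord 3)] j.
have cdelta (i j : 'I_5) : (c i == c j) = (i == j).
  by case: i j => [[|[|[|[|[|//]]]]] ?] [[|[|[|[|[|//]]]]] ?];
    rewrite /c /= !xpair_eqE -!val_eqE /= ?inordK //.
have [a Ca a0] := regular_tuple k 3 (l 0).
(* All products [E i *m E j] vanish, because column indices are at least 2 and row indices below
   2. *)
pose E i : 'M[k]_4 := if (i < 4)%N then delta_mx (c i.+1).1 (c i.+1).2 else 0.
have EE i j : E i *m E j = 0.
  rewrite /E; case: ifP => [lti|_]; last by rewrite mul0mx.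
  case: ifP => [ltj|_]; last by rewrite mulmx0.
  apply: mul_delta_mx_0; move: i j lti ltj.
  by move=> [|[|[|[|i]]]] [|[|[|[|j]]]] // _ _; rewrite -val_eqE /= ?inordK //.
apply: (@reducible_of_zero_divisors _ _ _ _
  (fun v => (tnth v (l 0) ^+ 3) 0 ord_max)
  (fun v => \det (\matrix_(i < 5, j < 5) B v i (c j).1 (c j).2))
  a [tuple E i | i < r]) => //.
- exact/polynomial_mxfunX/polynomial_mxfun_tnth.
- apply: polynomial_fun_det => i j; rewrite /B.
  have [i0|i0] := eqVneq i 0.
    have [p pE] := polynomial_fun_cst r 4 ((1%:M : 'M[k]_4) (c j).1 (c j).2).
    by exists p => v; rewrite mxE i0 -pE.
  have [p pE] := @polynomial_mxfun_tnth k r 4 (l i.-1) (c j).1 (c j).2.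
  by exists p => v; rewrite mxE (negbTE i0) -pE.
- move=> v Cv v0; apply: (@det_commutant_eq0 _ _ _ (tnth v (l 0)) (B v)) => //.
    exact: commuting_nilpotent_exp.
  move=> i; rewrite /B; case: ifP => _; first exact: comm1mx.
  exact: commuting_nilpotent_comm.
- apply: (@commuting_nilpotent_nth _ _ _ _ 2) => [i|i j]; last by rewrite !EE.
  by rewrite expr2 [LHS]EE.
- suff -> : \matrix_(i < 5, j < 5)
      B [tuple E i | i < r] i (c j).1 (c j).2 = 1%:M.
    by rewrite det1 oner_neq0.
  apply/matrixP => i j; rewrite !mxE /B.
  have [->|i0] := eqVneq i 0.
    by rewrite mxE; case: j => [[|[|[|[|[|//]]]]] ?];
      rewrite -!val_eqE /= ?inordK //.
  have i1 : (i.-1 < 4)%N by case: i i0 => [[|i] ?] //.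
  rewrite tnth_mktuple lE // /E i1 prednK ?lt0n // mxE -xpair_eqE.
  by rewrite -!surjective_pairing cdelta eq_sym.
Qed.

(** * Simultaneous strict triangularization *)

(** Matrices are added one at a time: if [u] is killed by the previous ones, the last nonzero
    [V i ^+ p *m u] is killed by [V i] and, by commutation, still by the others. *)
Lemma common_kernel (F : fieldType) r n (V : 'I_r -> 'M[F]_n.+1) m :
  (forall i, V i ^+ m = 0) -> (forall i j, comm_mx (V i) (V j)) ->
  exists2 u : 'cV[F]_n.+1, u != 0 & forall i, V i *m u = 0.
Proof.
move=> nilV commV.
suff [u u0 Vu] : exists2 u : 'cV[F]_n.+1, u != 0 &
    forall i, i \in enum 'I_r -> V i *m u = 0.
  by exists u => // i; rewrite Vu ?mem_enum.
elim: (enum 'I_r) => [|i s [u u0 Vu]].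
  by exists (delta_mx 0 0) => //; apply/eqP => /matrixP/(_ 0 0)/eqP;
    rewrite !mxE eqxx oner_eq0.
have ex_m : exists m, V i ^+ m *m u == 0 by exists m; rewrite nilV mul0mx.
case: (ex_minnP ex_m) => -[|p /eqP Vpu minp].
  by rewrite mul1mx (negbTE u0).
exists (V i ^+ p *m u) => [|j].
  by apply/negP => /minp; rewrite ltnn.
rewrite in_cons => /predU1P[->|sj]; first by rewrite mulmxA -[V i *m _]exprS.
have -> : V j *m (V i ^+ p *m u) = V i ^+ p *m (V j *m u).
  by rewrite !mulmxA; congr (_ *m u); exact: commrX (commV j i).
by rewrite Vu // mulmx0.
Qed.

Lemma first_column_unit (F : fieldType) n (u : 'cV[F]_n.+1) :
  u != 0 -> exists2 H : 'M_n.+1, H \in unitmx & col 0 H = u.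
Proof.
move=> u0; have rk1 : \rank u = 1%N.
  by apply/eqP; rewrite eqn_leq rank_leq_col lt0n mxrank_eq0.
have rU := row_ebase_unit u.
have c0 : row_ebase u 0 0 != 0.
  move: rU; rewrite [row_ebase u]mx11_scalar unitmxE det_scalar1 unitfE.
  by rewrite mxE mulr1n.
(* In the rank-one factorization of [u], the row factor is a 1 x 1 scalar, so [u] is this multiple
   of the first column of [col_ebase u]. *)
exists (row_ebase u 0 0 *: col_ebase u).
  by rewrite unitmxZ ?col_ebase_unit // unitfE.
rewrite -[RHS](mulmx_ebase u) rk1 [in RHS](mx11_scalar (row_ebase u)).
rewrite mul_mx_scalar colE -scalemxAl; congr (_ *: (_ *m _)).
by apply/matrixP => i j; rewrite !mxE ord1 eqxx andbT; case: i => [[|?] ?].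
Qed.

Definition strict_mx (R : pzRingType) n (T : 'M[R]_n) :=
  forall i j : 'I_n, (j <= i)%N -> T i j = 0.

Lemma strict_mx_exp (R : pzRingType) n (T : 'M[R]_n) :
  strict_mx T -> T ^+ n = 0.
Proof.
move=> sT; suff TX m (i j : 'I_n) : (j < i + m)%N -> (T ^+ m) i j = 0.
  by apply/matrixP => i j; rewrite mxE TX // (leq_trans (ltn_ord j)) ?leq_addl.
elim: m i => [|m IHm] i ltj.
  by rewrite expr0 mxE; case: eqP ltj => // ->; rewrite addn0 ltnn.
rewrite exprS mxE big1 // => l _.
have [le_li|lt_il] := leqP l i; first by rewrite sT ?mul0r.
by rewrite IHm ?mulr0 // (leq_trans ltj) // addnS -addSn leq_add2r.
Qed.

Lemma drsubmxM (R : pzRingType) n (X Y : 'M[R]_(1 + n)) :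
  dlsubmx X = 0 -> drsubmx (X *m Y) = drsubmx X *m drsubmx Y.
Proof.
move=> X0; rewrite -[X in LHS]submxK -[Y in LHS]submxK mulmx_block.
by rewrite block_mxKdr X0 mul0mx add0r.
Qed.

Lemma drsubmxX (R : pzRingType) n (X : 'M[R]_(1 + n)) m :
  dlsubmx X = 0 -> drsubmx (X ^+ m) = drsubmx X ^+ m.
Proof.
move=> X0; elim: m => [|m IHm]; last by rewrite !exprS drsubmxM // IHm.
by apply/matrixP => i j; rewrite !mxE (inj_eq (@rshift_inj _ _)).
Qed.

(** Taking a common kernel vector as first basis vector clears the first columns; the lower right
    blocks are again commuting and nilpotent, and induction applies to them. *)
Lemma strict_triangularization (F : fieldType) r n (V : 'I_r -> 'M[F]_n) m :
  (forall i, V i ^+ m = 0) -> (forall i j, comm_mx (V i) (V j)) ->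
  exists H : 'M_n, exists T : 'I_r -> 'M_n,
    [/\ H \in unitmx, forall i, strict_mx (T i)
      & forall i, V i *m H = H *m T i].
Proof.
elim: n V => [|n IHn] V nilV commV.
  exists 1%:M, V; split=> [|i []//|i]; first exact: unitmx1.
  by rewrite mulmx1 mul1mx.
have [u u0 Vu] := common_kernel nilV commV.
have [H HU Hu] := first_column_unit u0.
pose M i : 'M_(1 + n) := invmx H *m V i *m H.
have Mcol i : lsubmx (M i) = 0.
  have : col 0 (M i) = 0 by rewrite colE -mulmxA -colE Hu -mulmxA Vu mulmx0.
  move/colP => M0; apply/matrixP => a b; rewrite ord1 [LHS]mxE [RHS]mxE.
  have := M0 a; rewrite [LHS]mxE [RHS]mxE => Ma; rewrite -[RHS]Ma.
  by congr (M i _ _); apply: val_inj.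
have MX i p : M i ^+ p = invmx H *m V i ^+ p *m H.
  elim: p => [|p IHp]; first by rewrite !expr0 mulmx1 mulVmx.
  by rewrite !exprS IHp /M -!mulmxE !mulmxA mulmxK.
have MM i j : M i *m M j = invmx H *m (V i *m V j) *m H.
  by rewrite /M !mulmxA mulmxK.
have Mdl i : dlsubmx (M i) = 0.
  apply/matrixP => a b; have /matrixP/(_ (rshift 1 a) b) := Mcol i.
  by rewrite !mxE.
have Mul i : ulsubmx (M i) = 0.
  apply/matrixP => a b; have /matrixP/(_ (lshift n a) b) := Mcol i.
  by rewrite !mxE.
have [||h [T [hU sT MT]]] := IHn (fun i => drsubmx (M i)).
- move=> i; rewrite -drsubmxX // MX nilV mulmx0 mul0mx.
  by apply/matrixP => a b; rewrite !mxE.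
- by move=> i j; rewrite /comm_mx -!drsubmxM // !MM commV.
pose L : 'M_(1 + n) := block_mx 1%:M 0 0 h.
have LU : L \in unitmx by rewrite unitmxE det_ublock det1 mul1r -unitmxE.
pose U i : 'M_(1 + n) := block_mx 0 (ursubmx (M i) *m h) 0 (T i).
exists (H *m L), U.
split=> [|i|i]; first by rewrite unitmx_mul HU.
  move=> a b; rewrite /U.
  case: (@split_ordP 1 n a) => a' ->; case: (@split_ordP 1 n b) => b' -> leab.
  - by apply: etrans (block_mxEul _ _ _ _ a' b') _; rewrite mxE.
  - by move: leab; rewrite ord1.
  - by apply: etrans (block_mxEdl _ _ _ _ a' b') _; rewrite mxE.
  - by apply: etrans (block_mxEdr _ _ _ _ a' b') _; rewrite sT.
have Lconj : M i *m L = L *m U i.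
  rewrite -[M i]submxK Mdl Mul /L /U !mulmx_block.
  by rewrite !(mulmx0, mul0mx, mul1mx, addr0, add0r) MT.
by rewrite -mulmxA -Lconj /M !mulmxA mulmxV // mul1mx.
Qed.

(** * Irreducibility in sizes up to 3 *)

Definition line_poly (R : nzRingType) (a b : R) : {poly R} :=
  a%:P + (b - a) *: 'X.

Lemma horner_line0 (R : nzRingType) (a b : R) : (line_poly a b).[0] = a.
Proof. by rewrite hornerD hornerC hornerZ hornerX mulr0 addr0. Qed.

Lemma horner_line1 (R : nzRingType) (a b : R) : (line_poly a b).[1] = b.
Proof. by rewrite hornerD hornerC hornerZ hornerX mulr1 addrC subrK. Qed.

(** The 2 x 2 minors vanish, so the pairs (a i, b i) form a matrix of rank at most one. *)
Lemma proportional_pairs (F : fieldType) (I : finType) (a b : I -> F) :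
  (forall i j, a i * b j = a j * b i) ->
  exists x y s, forall i, a i = s i * x /\ b i = s i * y.
Proof.
move=> ab; have [a0|/forallPn[l al]] := boolP [forall i, a i == 0].
  by exists 0, 1, b => i; rewrite mulr0 mulr1 (eqP (forallP a0 i)).
exists (a l), (b l), (fun i => a i / a l) => i; rewrite divfK //; split=> //.
by rewrite mulrAC ab mulrAC divff // mul1r.
Qed.

Definition strict_mx3 (R : pzRingType) (a b c : R) : 'M[R]_3 :=
  \matrix_(i, j) (if (i == 0 :> nat) && (j == 1 :> nat) then a
    else if (i == 1 :> nat) && (j == 2 :> nat) then b
    else if (i == 0 :> nat) && (j == 2 :> nat) then c else 0).

Lemma strict_mx3_strict (R : pzRingType) (a b c : R) :
  strict_mx (strict_mx3 a b c).
Proof.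
by move=> [[|[|[|//]]] ?] [[|[|[|//]]] ?]; rewrite mxE.
Qed.

Lemma strict_mx3E (R : pzRingType) (T : 'M[R]_3) :
  strict_mx T -> T = strict_mx3 (T 0 1) (T 1 (inord 2)) (T 0 (inord 2)).
Proof.
move=> sT; apply/matrixP => i j; rewrite mxE.
case: i j => [[|[|[|//]]] ?] [[|[|[|//]]] ?] /=; try by rewrite sT.
all: by congr (T _ _); apply: val_inj => //=; rewrite inordK.
Qed.

Lemma strict_mx3M (R : pzRingType) (a b c a' b' c' : R) :
  strict_mx3 a b c *m strict_mx3 a' b' c' = strict_mx3 0 0 (a * b').
Proof.
apply/matrixP => i j; rewrite !mxE !big_ord_recl big_ord0 !mxE.
by case: i j => [[|[|[|//]]] ?] [[|[|[|//]]] ?] /=;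
  rewrite ?(mulr0, mul0r, addr0, add0r).
Qed.

Lemma map_strict_mx3 (R S : pzRingType) (f : {rmorphism R -> S}) (a b c : R) :
  map_mx f (strict_mx3 a b c) = strict_mx3 (f a) (f b) (f c).
Proof.
apply/matrixP => i j; rewrite !mxE; do 3![case: ifP => // _].
by rewrite rmorph0.
Qed.

Lemma comm_strict_mx_curve (F : fieldType) r n (T T' : 'I_r -> 'M[F]_n) :
  (n <= 3)%N -> (forall i, strict_mx (T i)) -> (forall i, strict_mx (T' i)) ->
  (forall i j, comm_mx (T i) (T j)) -> (forall i j, comm_mx (T' i) (T' j)) ->
  exists U : 'I_r -> 'M[{poly F}]_n,
    [/\ forall i, strict_mx (U i), forall i j, comm_mx (U i) (U j),
        forall i, map_mx (horner_eval 0) (U i) = T i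
      & forall i, map_mx (horner_eval 1) (U i) = T' i].
Proof.
rewrite leq_eqVlt => /predU1P[n3|lt_n3] sT sT' cT cT'.
  subst n.
  have prop (S : 'I_r -> 'M[F]_3) : (forall i, strict_mx (S i)) ->
      (forall i j, comm_mx (S i) (S j)) -> exists x y s c,
      forall i, S i = strict_mx3 (s i * x) (s i * y) (c i).
    move=> sS cS.
    have [i j|x [y [s xys]]] := @proportional_pairs F 'I_r
        (fun i => S i 0 1) (fun i => S i 1 (inord 2)).
      have := cS i j.
      rewrite /comm_mx (strict_mx3E (sS i)) (strict_mx3E (sS j)).
      rewrite !strict_mx3M => /matrixP/(_ 0 (inord 2)).
      by rewrite !mxE /= !inordK.
    exists x, y, s, (fun i => S i 0 (inord 2)) => i.
    by rewrite [LHS](strict_mx3E (sS i)) (xys i).1 (xys i).2.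
  have [x [y [s [c TE]]]] := prop T sT cT.
  have [x' [y' [s' [c' TE']]]] := prop T' sT' cT'.
  (* Interpolating the parameters [x], [y], [s], [c], rather than the entries, preserves
     proportionality and hence commutation. *)
  exists (fun i => strict_mx3 (line_poly (s i) (s' i) * line_poly x x')
    (line_poly (s i) (s' i) * line_poly y y') (line_poly (c i) (c' i))).
  split=> [i|i j|i|i]; first exact: strict_mx3_strict.
  - by rewrite /comm_mx !strict_mx3M; congr strict_mx3; ring.
  - rewrite (map_strict_mx3 (horner_eval 0)) TE.
    by rewrite /= /horner_eval !hornerM !horner_line0.
  - rewrite (map_strict_mx3 (horner_eval 1)) TE'.
    by rewrite /= /horner_eval !hornerM !horner_line1.
(* In size at most 2 all products of strictly triangular matrices vanish, so a straight segment
   suffices. *)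
exists (fun i => \matrix_(a, b) line_poly (T i a b) (T' i a b)).
have sU i : strict_mx (\matrix_(a, b) line_poly (T i a b) (T' i a b)).
  by move=> a b leba; rewrite mxE sT // sT' // /line_poly subrr scale0r addr0.
split=> // [i j|i|i].
- suff UU0 i' j' : (\matrix_(a, b) line_poly (T i' a b) (T' i' a b)) *m
      (\matrix_(a, b) line_poly (T j' a b) (T' j' a b)) = 0.
    by rewrite /comm_mx !UU0.
  apply/matrixP => a b; rewrite !mxE big1 // => l _.
  have [le_la|lt_al] := leqP l a; first by rewrite sU ?mul0r.
  rewrite [X in _ * X]sU ?mulr0 //.
  by have := ltn_ord b; lia.
- by apply/matrixP => a b; rewrite !mxE /horner_eval horner_line0.
- by apply/matrixP => a b; rewrite !mxE /horner_eval horner_line1.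
Qed.

(* Replacing [invmx g] by [\adj g] keeps the conjugates commuting and nilpotent
   for singular [g] and makes them polynomial in [g]. *)
Lemma commuting_nilpotent_adj (k : closedFieldType) r n (g : 'M[k]_n)
    (T : 'I_r -> 'M[k]_n) :
  (forall i, strict_mx (T i)) -> (forall i j, comm_mx (T i) (T j)) ->
  commuting_nilpotent [tuple g *m T i *m \adj g | i < r].
Proof.
move=> sT cT.
have gM (X Y : 'M[k]_n) : g *m X *m \adj g *m (g *m Y *m \adj g) =
    \det g *: (g *m (X *m Y) *m \adj g).
  rewrite -!mulmxA (mulmxA (\adj g)) mul_adj_mx mul_scalar_mx.
  by rewrite -!scalemxAr.
apply: (@commuting_nilpotent_nth _ _ _ _ n.+1) => [i|i j]; last first.
  by rewrite !gM cT.
suff gX m : exists c,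
    (g *m T i *m \adj g) ^+ m.+1 = c *: (g *m T i ^+ m.+1 *m \adj g).
  have [c ->] := gX n; rewrite exprS strict_mx_exp // mulr0 mulmx0.
  by rewrite mul0mx scaler0.
elim: m => [|m [c IHm]]; first by exists 1; rewrite scale1r.
exists (c * \det g).
by rewrite exprS IHm -mulmxE -scalemxAr gM [in RHS]exprS scalerA.
Qed.

Lemma commuting_nilpotent_triangular (k : closedFieldType) r n
    (v : mx_tuple k r n.+1) : commuting_nilpotent v ->
  exists g : 'M[k]_n.+1, exists T : 'I_r -> 'M[k]_n.+1,
    [/\ forall i, strict_mx (T i), forall i j, comm_mx (T i) (T j)
      & v = [tuple g *m T i *m \adj g | i < r]].
Proof.
move=> Cv; have [i|i j|H [T [HU sT VH]]] :=
  @strict_triangularization k r n.+1 (fun i => tnth v i) n.+1.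
- exact: commuting_nilpotent_exp.
- exact: commuting_nilpotent_comm.
have TE i : T i = invmx H *m tnth v i *m H by rewrite -mulmxA VH mulKmx.
(* The scalar turns [\adj H] into [invmx H]. *)
exists H, (fun i => (\det H)^-1 *: T i); split=> [i a b leba|i j|].
- by rewrite mxE sT ?mulr0.
- rewrite /comm_mx -!scalemxAl -!scalemxAr; do 2![congr (_ *: _)].
  rewrite !TE !mulmxA !(mulmxKV HU, mulmxK HU); congr (_ *m _).
  by rewrite -!mulmxA; congr (_ *m _); apply: commuting_nilpotent_comm.
apply/eq_from_tnth => i; rewrite tnth_mktuple -scalemxAr -scalemxAl scalemxAr.
have -> : (\det H)^-1 *: \adj H = invmx H by rewrite /invmx HU.
by rewrite -VH mulmxK.
Qed.

Lemma irreducible_le3 (k : closedFieldType) r n :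
  (n < 3)%N -> irreducible (@commuting_nilpotent k r n.+1).
Proof.
move=> len3; apply: irreducible_of_curves => [|v w Cv Cw].
  exists [tuple 0 | i < r].
  by apply: (@commuting_nilpotent_nth _ _ _ _ 1).
have [g [T [sT cT vE]]] := commuting_nilpotent_triangular Cv.
have [h [S [sS cS wE]]] := commuting_nilpotent_triangular Cw.
have [U [sU cU U0 U1]] := comm_strict_mx_curve len3 sT sS cT cS.
(* The segment from [g] to [h] may meet singular matrices; conjugation through the adjugate stays in
   the variety there. *)
pose G : 'M_n.+1 := \matrix_(i, j) line_poly (g i j) (h i j).
have GU t : horner_tuple (fun i => G *m U i *m \adj G) t =
    [tuple map_mx (horner_eval t) G *m map_mx (horner_eval t) (U i) *m
       \adj (map_mx (horner_eval t) G) | i < r].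
  by apply/eq_from_tnth => i; rewrite !tnth_mktuple !map_mxM map_mx_adj.
exists (fun i => G *m U i *m \adj G); split=> [t||].
- rewrite GU; apply: commuting_nilpotent_adj => [i a b leba|i j].
    by rewrite mxE sU // /horner_eval horner0.
  by rewrite /comm_mx -!map_mxM cU.
- rewrite GU vE; have -> : map_mx (horner_eval 0) G = g.
    by apply/matrixP => i j; rewrite !mxE; apply: horner_line0.
  by apply/eq_from_tnth => i; rewrite !tnth_mktuple U0.
- rewrite GU wE; have -> : map_mx (horner_eval 1) G = h.
    by apply/matrixP => i j; rewrite !mxE; apply: horner_line1.
  by apply/eq_from_tnth => i; rewrite !tnth_mktuple U1.
Qed.

(** * Algebraic relations by counting dimensions *)

Lemma mcoeff_eq0_mdeg (k : fieldType) m d (p : mpoly m k) (u : multinom m) :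
  (mmeasure mdeg p <= d)%N -> (d <= mdeg u)%N -> mcoeff u p = 0.
Proof.
by move=> pd du; apply/memN_msupp_eq0/msize_mdeg_ge/(leq_trans pd).
Qed.

(** [mmeasure mdeg] is the total degree plus one, and 0 for the zero polynomial, whence [d.+1]. *)
Definition mpoly_deg_le (k : fieldType) m (d : nat) (p : mpoly m k) :=
  (mmeasure mdeg p <= d.+1)%N.

Lemma mpoly_deg_leM (k : fieldType) m d e (p q : mpoly m k) :
  mpoly_deg_le d p -> mpoly_deg_le e q -> mpoly_deg_le (d + e) (p * q).
Proof.
rewrite /mpoly_deg_le => pd qe.
have [->|p0] := eqVneq p 0; first by rewrite mul0r msize0.
have [->|q0] := eqVneq q 0; first by rewrite mulr0 msize0.
rewrite msizeM //; have := leq_sub2r 1 (leq_add pd qe).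
by rewrite addSn addnS !subn1.
Qed.

Lemma mpoly_deg_le1 (k : fieldType) m : mpoly_deg_le 0 (1 : mpoly m k).
Proof. by rewrite /mpoly_deg_le msize1. Qed.

Lemma mpoly_deg_leX (k : fieldType) m d e (p : mpoly m k) :
  mpoly_deg_le d p -> mpoly_deg_le (e * d) (p ^+ e).
Proof.
move=> pd; elim: e => [|e IHe]; first exact: mpoly_deg_le1.
by rewrite exprS mulSn; apply: mpoly_deg_leM.
Qed.

Lemma mpoly_deg_le_prod (k : fieldType) m (I : finType) (d : I -> nat)
    (p : I -> mpoly m k) :
  (forall i, mpoly_deg_le (d i) (p i)) ->
  mpoly_deg_le (\sum_i d i) (\prod_i p i).
Proof.
move=> pd; elim/big_rec2: _ => [|i e q _ qe]; first exact: mpoly_deg_le1.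
exact: mpoly_deg_leM.
Qed.

(** Total degree below [d] puts every exponent below [d]; this crude box bound has the right order
    of growth for fixed [m]. *)
Lemma card_bmultinom (m d : nat) : (#|{: bmultinom m d}| <= d ^ m)%N.
Proof.
have ltd (u : bmultinom m d) i : (u i < d)%N.
  by apply: leq_ltn_trans (bmdeg u); rewrite mdegE (bigD1 i) //= leq_addr.
pose f (u : bmultinom m d) := [ffun i => Ordinal (ltd u i)].
have f_inj : injective f.
  move=> u v /ffunP uv; apply/eqP; rewrite bmeqP; apply/eqP/mnmP => i.
  by have := uv i; rewrite !ffunE => -[].
by have := leq_card f f_inj; rewrite card_ffun !card_ord.
Qed.

(* A dimension count: as N grows there are N ^ q exponent vectors, while the
   products lie in a space of dimension O(N ^ m). *)
Lemma homogeneous_relation (k : fieldType) m q (f0 : mpoly m k)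
    (f : 'I_q -> mpoly m k) :
  (m < q)%N -> exists N, exists c : {ffun 'I_q -> 'I_N} -> k,
    (exists a, c a != 0) /\
    \sum_a c a *: ((\prod_i f i ^+ a i) * f0 ^+ (q * N - \sum_i a i)) = 0.
Proof.
move=> lt_mq.
pose d := (mmeasure mdeg f0 + \max_i mmeasure mdeg (f i))%N.
have f0d : mpoly_deg_le d f0 by rewrite /mpoly_deg_le /d; lia.
have fd i : mpoly_deg_le d (f i).
  rewrite /mpoly_deg_le /d.
  by have := leq_bigmax (F := fun i => mmeasure mdeg (f i)) i; lia.
(* The products have degree below K <= (qd+1)N, and (qd+1)^m < N yields K^m < N^(m+1) <= N^q. *)
pose N := ((q * d).+1 ^ m).+1; pose K := (q * N * d).+1; exists N.
pose g (a : {ffun 'I_q -> 'I_N}) :=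
  (\prod_i f i ^+ a i) * f0 ^+ (q * N - \sum_i a i).
have ga a : mpoly_deg_le (q * N * d) (g a).
  have le_aN : (\sum_i a i <= q * N)%N.
    rewrite -[q in (q * N)%N]card_ord -sum_nat_const.
    by apply: leq_sum => i _; exact: ltnW.
  have -> : (q * N * d = \sum_i a i * d + (q * N - \sum_i a i) * d)%N.
    by rewrite -big_distrl -mulnDl subnKC.
  by apply: mpoly_deg_leM; [apply: mpoly_deg_le_prod => i|];
    apply: mpoly_deg_leX.
have small : (#|{: bmultinom m K}| < #|{ffun 'I_q -> 'I_N}|)%N.
  rewrite card_ffun !card_ord; apply: leq_ltn_trans (card_bmultinom m K) _.
  have leK : (K <= (q * d).+1 * N)%N by rewrite /K /N; nia.
  have leX e : (K ^ e <= ((q * d).+1 * N) ^ e)%N.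
    by case: e => // e; rewrite leq_exp2r.
  apply: leq_ltn_trans (leX m) _.
  rewrite expnMn; apply: leq_trans (_ : N ^ m.+1 <= _)%N; last first.
    by rewrite leq_pexp2l.
  by rewrite expnS ltn_pmul2r // expn_gt0.
pose M : 'M[k]_(#|{ffun 'I_q -> 'I_N}|, #|{: bmultinom m K}|) :=
  \matrix_(a, u) mcoeff (enum_val u : bmultinom m K) (g (enum_val a)).
have : kermx M != 0.
  rewrite -mxrank_eq0 mxrank_ker -lt0n subn_gt0.
  by rewrite (leq_ltn_trans (rank_leq_col _)).
move=> /rowV0Pn[c /sub_kermxP cM c0].
exists (fun a => c 0 (enum_rank a)); split.
  by have /rV0Pn[a ca] := c0; exists (enum_val a); rewrite enum_valK.
apply/mpolyP => u; rewrite mcoeff0 raddf_sum /=.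
have [ltuK|leKu] := ltnP (mdeg u) K; last first.
  by rewrite big1 // => a _; rewrite mcoeffZ (mcoeff_eq0_mdeg (ga a)) ?mulr0.
have /rowP/(_ (enum_rank (BMultinom ltuK))) := cM; rewrite !mxE => E.
rewrite -[RHS]E (reindex_onto enum_val enum_rank) => [|a _]; last first.
  exact: enum_rankK.
rewrite (eq_bigl predT) => [|a]; last by rewrite enum_valK eqxx.
by apply: eq_bigr => a _; rewrite mcoeffZ enum_valK mxE enum_rankK.
Qed.

(** * Independence of monomials by Kronecker substitution *)

Lemma digits_inj N q :
  injective (fun a : {ffun 'I_q -> 'I_N} => \sum_i a i * N ^ i)%N.
Proof.
elim: q => [|q IHq] a b; first by move=> _; apply/ffunP => -[].
rewrite !big_ord_recl /= !expn0 !muln1.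
have shift (e : {ffun 'I_q.+1 -> 'I_N}) :
    (\sum_(i < q) e (lift ord0 i) * N ^ bump 0 i = 
     (\sum_(i < q) [ffun i => e (lift ord0 i)] i * N ^ i) * N)%N.
  rewrite big_distrl; apply: eq_bigr => i _.
  by rewrite ffunE /bump add1n expnSr mulnA.
rewrite !shift => E; have N0 : (0 < N)%N by case: (N) (a ord0) => [[]|].
have E0 : a ord0 = b ord0.
  apply: val_inj; have := congr1 (modn^~ N) E.
  by rewrite ![(_ + _ * N)%N]addnC !modnMDl !modn_small.
have /IHq/ffunP ab : (\sum_(i < q) [ffun i => a (lift ord0 i)] i * N ^ i =
    \sum_(i < q) [ffun i => b (lift ord0 i)] i * N ^ i)%N.
  by move: E; rewrite E0 => /addnI/eqP; rewrite eqn_pmul2r // => /eqP.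
apply/ffunP => i; case: (unliftP ord0 i) => [j ->|-> //].
by have := ab j; rewrite !ffunE.
Qed.

(* Kronecker substitution: y i = t ^ N ^ i turns the monomials into distinct
   powers of t. *)
Lemma box_monomials_independent (k : closedFieldType) q N
    (c : {ffun 'I_q -> 'I_N} -> k) a0 :
  c a0 != 0 -> exists y : nat -> k, \sum_a c a * \prod_(i < q) y i ^+ a i != 0.
Proof.
move=> ca0; pose e (a : {ffun 'I_q -> 'I_N}) := (\sum_i a i * N ^ i)%N.
pose P : {poly k} := \sum_a c a *: 'X^(e a).
have /closed_nonrootP[t Pt] : P != 0.
  apply/eqP => /polyP/(_ (e a0))/eqP; rewrite coef0 coef_sum (bigD1 a0) //=.
  rewrite big1 => [|a aa0]; rewrite coefZ coefXn.
    by rewrite eqxx mulr1 addr0 (negbTE ca0).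
  by rewrite (inj_eq (@digits_inj N q)) eq_sym (negbTE aa0) mulr0.
exists (fun i => t ^+ (N ^ i)); move: Pt; rewrite /root horner_sum.
apply: contraNneq => E; rewrite -[X in _ == X]E; apply/eqP/eq_bigr => a _.
rewrite hornerZ hornerXn -prodrXr; congr (_ * _).
by apply: eq_bigr => i _; rewrite -exprM mulnC.
Qed.

(** * Plucker coordinates of commuting triples *)

(* [(a, b, c)] stands for the monomial x^a y^b z^c. *)
Definition monomial3 : eqType := (nat * nat * nat)%type.

Definition degree3 (t : monomial3) : nat := t.1.1 + t.1.2 + t.2.

Definition shift3 (m : nat) (l : 'I_3) (t : monomial3) : monomial3 :=
  (t.1.1 + m * (l == 0 :> nat), t.1.2 + m * (l == 1 :> nat),
   t.2 + m * (l == 2 :> nat))%N.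

Lemma degree_shift3 m l t : degree3 (shift3 m l t) = (degree3 t + m)%N.
Proof. by rewrite /degree3 /shift3; case: l => [[|[|[|//]]] ?] /=; lia. Qed.

Lemma shift3S m l t : shift3 m.+1 l t = shift3 1 l (shift3 m l t).
Proof. by rewrite /shift3 /= !mul1n !mulSn !addnA !(addnAC _ (_ == _)). Qed.

Lemma shift3C l l' t : shift3 1 l (shift3 1 l' t) = shift3 1 l' (shift3 1 l t).
Proof. by rewrite /shift3 /= !mul1n !(addnAC _ (l == _ :> nat)). Qed.

(** Image of the monomial [t] under the evaluation map f |-> e_0 f(A, B, C), whose maximal minors
    are the values of [plucker]. *)
Definition plucker_row (k : closedFieldType) n (v : mx_tuple k 3 n.+1)
    (t : monomial3) : 'rV[k]_n.+1 :=
  row 0 (tnth v 0 ^+ t.1.1 *m tnth v 1 ^+ t.1.2 *m tnth v (inord 2) ^+ t.2).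

Definition plucker (k : closedFieldType) n (s : 'I_n.+1 -> monomial3)
    (v : mx_tuple k 3 n.+1) : k := \det (\matrix_i plucker_row v (s i)).

Lemma polynomial_fun_plucker (k : closedFieldType) n
    (s : 'I_n.+1 -> monomial3) :
  polynomial_fun (@plucker k n s).
Proof.
apply: polynomial_fun_det => i j.
have pX l m : polynomial_mxfun (fun v : mx_tuple k 3 n.+1 => tnth v l ^+ m).
  exact/polynomial_mxfunX/polynomial_mxfun_tnth.
have [p pE] : polynomial_fun (fun v : mx_tuple k 3 n.+1 =>
    (tnth v 0 ^+ (s i).1.1 *m tnth v 1 ^+ (s i).1.2 *m
     tnth v (inord 2) ^+ (s i).2) 0 j).
  exact: (polynomial_mxfunM (polynomial_mxfunM (pX _ _) (pX _ _)) (pX _ _)).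
by exists p => v; rewrite !mxE -pE mxE.
Qed.

(** Independent indeterminates as coefficients: the two shifts give disjoint sets of them, for the
    polynomials expressing B and C in A. *)
Definition generic_poly (k : closedFieldType) n (h : 'I_n -> 'I_(n + n)) :
    {poly mpoly (n + n) k} :=
  rVpoly (\row_j mpolyX k (mnm1 (h j))).

(** The same minor in the model k[X]/(X^n), with x acting as X and y, z as generic polynomials in
    X. *)
Definition regular_plucker (k : closedFieldType) n (s : 'I_n -> monomial3) :
    mpoly (n + n) k :=
  \det (\matrix_(i, j < n) ('X^((s i).1.1) *
    generic_poly k (@lshift n n) ^+ (s i).1.2 *
    generic_poly k (@rshift n n) ^+ (s i).2)`_j).

(** With B = p(A) and C = q(A), each row is a vector of truncated coefficients times the Krylov
    matrix, whose determinant is the factor [c] common to all [s]. *)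
Lemma plucker_regular (k : closedFieldType) n (v : mx_tuple k 3 n.+1) :
  commuting_nilpotent v -> (tnth v 0 ^+ n) 0 ord_max != 0 ->
  exists x c, forall s, plucker s v = meval x (regular_plucker k s) * c.
Proof.
move=> Cv v0; have An := commuting_nilpotent_exp 0 Cv.
have [p pE] := commutant_regular_nilpotent An v0
  (commuting_nilpotent_comm 1 0 Cv).
have [q qE] := commutant_regular_nilpotent An v0
  (commuting_nilpotent_comm (inord 2) 0 Cv).
pose x i := (row_mx p q) 0 i; exists x, (\det (krylov_mx (tnth v 0))) => s.
have xE (h : 'I_n.+1 -> 'I_(n.+1 + n.+1)) (w : 'rV_n.+1) :
    (forall j, x (h j) = w 0 j) ->
    map_poly (meval x) (generic_poly k h) = rVpoly w.
  move=> xh; rewrite map_rVpoly; congr rVpoly.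
  by apply/rowP => j; rewrite !mxE -xh; apply: mevalXU.
rewrite /regular_plucker -det_map_mx -det_mulmx; congr (\det _).
apply/row_matrixP => i; rewrite row_mul rowK.
have AX m : tnth v 0 ^+ m = horner_mx (tnth v 0) 'X^m.
  by rewrite rmorphXn /= horner_mx_X.
rewrite /plucker_row pE qE AX -!rmorphXn !mulmxE -!rmorphM /=.
rewrite row0_horner_mx //; congr (_ *m _).
apply/rowP => j; rewrite !mxE -coef_map !rmorphM /= !rmorphXn /= map_polyX.
by rewrite (xE _ p) ?(xE _ q) // => l; rewrite /x ?row_mxEl ?row_mxEr.
Qed.

(** * Algebras with Hilbert function (1,3,6,10,6) *)

Definition monomials_lt5 : seq monomial3 :=
  allpairs pair (allpairs pair (iota 0 5) (iota 0 5)) (iota 0 5).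

Definition quartics : seq monomial3 :=
  [seq t <- monomials_lt5 | degree3 t == 4].

(** The 1 + 3 + 6 + 10 monomials of degree at most 3 occupy positions below 20, with 1 in position
    0; six of the fifteen quartics fill positions 20 to 25. *)
Definition basis_monomials : seq monomial3 :=
  [seq t <- monomials_lt5 | (degree3 t <= 3)%N] ++ take 6 quartics.

Definition other_quartics : seq monomial3 := drop 6 quartics.

Local Notation basis_monomial i := (nth (0, 0, 0)%N basis_monomials i).

Lemma size_basis_monomials : size basis_monomials = 26.
Proof. by []. Qed.

Lemma uniq_basis_monomials : uniq basis_monomials.
Proof. by []. Qed.

Lemma mem_basis_monomials t : (degree3 t <= 3)%N -> t \in basis_monomials.
Proof.
rewrite /degree3; case: t => -[a b] c /= le3.
by move: a b c le3 => [|[|[|[|a]]]] [|[|[|[|b]]]] [|[|[|[|c]]]] //=; lia.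
Qed.

Lemma degree_basis_monomials t : t \in basis_monomials -> (degree3 t <= 4)%N.
Proof. by move: t; apply/allP. Qed.

Lemma degree_basis_top i :
  (20 <= i < 26)%N -> degree3 (basis_monomial i) = 4.
Proof.
by do 26![case: i => [|i] //].
Qed.

Lemma degree_other_quartics t : t \in other_quartics -> degree3 t = 4.
Proof. by move=> ot; apply/eqP; move: t ot; apply/allP. Qed.

Lemma other_quartics_notin t : t \in other_quartics -> t \notin basis_monomials.
Proof. by move: t; apply/allP. Qed.

Local Opaque basis_monomials other_quartics.

(* Normal form of a monomial in k[x,y,z]/I, where I contains all quintics and
   each of the nine other quartics is identified with a linear combination of
   the six basis quartics, with coefficients 6 u + j, j < 6. *)
Definition normal_form (k : closedFieldType) (y : nat -> k)
    (t : monomial3) : 'rV[k]_26 :=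
  \row_j if t \in basis_monomials then (basis_monomial j == t)%:R
    else if (t \in other_quartics) && (20 <= j)%N
    then y (6 * index t other_quartics + (j - 20))%N else 0.

(** Multiplication by the [l]-th variable on k[x,y,z]/I, acting on row vectors. *)
Definition quotient_mx (k : closedFieldType) (y : nat -> k)
    (l : 'I_3) : 'M[k]_26 :=
  \matrix_i normal_form y (shift3 1 l (basis_monomial i)).

Lemma normal_form_high (k : closedFieldType) (y : nat -> k) t :
  (4 < degree3 t)%N -> normal_form y t = 0.
Proof.
move=> lt4; apply/rowP => j; rewrite !mxE ifN; last first.
  by apply: contraL lt4 => /degree_basis_monomials; rewrite leqNgt.
by case: ifP => // /andP[/degree_other_quartics t4]; rewrite t4 in lt4.
Qed.

Lemma normal_form_nth (k : closedFieldType) (y : nat -> k) (i : 'I_26) :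
  normal_form y (basis_monomial i) = delta_mx 0 i.
Proof.
apply/rowP => j; rewrite !mxE mem_nth ?size_basis_monomials // eqxx.
by rewrite nth_uniq ?size_basis_monomials ?uniq_basis_monomials.
Qed.

(** Off the basis, [t] has degree at least 4 and its normal form involves only quartics, so both
    sides vanish in degree 5. Hence the parameters [y] are subject to no constraint. *)
Lemma mul_quotient_mx (k : closedFieldType) (y : nat -> k) l t :
  normal_form y t *m quotient_mx y l = normal_form y (shift3 1 l t).
Proof.
have [bt|nbt] := boolP (t \in basis_monomials).
  have ti : (index t basis_monomials < 26)%N by rewrite -index_mem in bt.
  have tE : t = basis_monomial (Ordinal ti) by rewrite nth_index.
  by rewrite [in LHS]tE normal_form_nth -rowE rowK -tE.
have t4 : (3 < degree3 t)%N.
  by rewrite ltnNge; apply: contra nbt => /mem_basis_monomials.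
rewrite [RHS]normal_form_high ?degree_shift3 ?addn1 //.
apply/rowP => j; rewrite mxE [RHS]mxE big1 // => i _; rewrite mxE (negbTE nbt).
case: ifP => [/andP[_ le20i]|]; last by rewrite mul0r.
rewrite mxE normal_form_high ?mxE ?mulr0 //.
by rewrite degree_shift3 degree_basis_top ?le20i ?ltn_ord.
Qed.

Lemma mul_quotient_mxX (k : closedFieldType) (y : nat -> k) l m t :
  normal_form y t *m quotient_mx y l ^+ m = normal_form y (shift3 m l t).
Proof.
elim: m => [|m IHm].
  by rewrite expr0 mulmx1 /shift3 !mul0n !addn0; case: t => -[].
by rewrite shift3S -mul_quotient_mx -IHm exprSr mulmxA.
Qed.

Definition quotient_tuple (k : closedFieldType) (y : nat -> k) :
    mx_tuple k 3 26 :=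
  [tuple quotient_mx y l | l < 3].

Lemma quotient_tuple_commuting (k : closedFieldType) (y : nat -> k) :
  commuting_nilpotent (quotient_tuple y).
Proof.
apply: (@commuting_nilpotent_nth _ _ _ _ 5) => [l|l l'].
  apply/row_matrixP => i.
  rewrite rowE -(normal_form_nth y) mul_quotient_mxX row0.
  by rewrite normal_form_high // degree_shift3 ltn_addl.
have quotientM i l1 l2 :
    delta_mx 0 i *m (quotient_mx y l1 *m quotient_mx y l2) =
    normal_form y (shift3 1 l2 (shift3 1 l1 (basis_monomial i))).
  by rewrite mulmxA -(normal_form_nth y) mul_quotient_mx mul_quotient_mx.
apply/row_matrixP => i; rewrite [LHS]rowE [RHS]rowE.
by rewrite [LHS]quotientM [RHS]quotientM; congr normal_form; apply: shift3C.
Qed.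

Lemma plucker_row_quotient (k : closedFieldType) (y : nat -> k) t :
  plucker_row (quotient_tuple y) t = normal_form y t.
Proof.
rewrite /plucker_row rowE -[delta_mx 0 0](normal_form_nth y).
rewrite !tnth_mktuple !mulmxA !mul_quotient_mxX; congr normal_form.
by rewrite /shift3 /= !inordK //= !muln0 !muln1 !addn0 !add0n; case: t => -[].
Qed.

(** * Reducibility in size 26 for r = 3 *)

(** Cofactors along row [r] only see the other rows, so they are those of the identity. *)
Lemma det_replace_row (R : comNzRingType) n (M : 'M[R]_n) r :
  (forall i, i != r -> row i M = row i 1%:M) -> \det M = M r r.
Proof.
move=> MI; rewrite (expand_det_row M r).
have cofE j : cofactor M r j = (j == r)%:R.
  have -> : cofactor M r j = cofactor 1%:M r j.
    rewrite /cofactor; congr (_ * \det _); apply/matrixP => a b; rewrite !mxE.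
    have lr : lift r a != r by rewrite eq_sym neq_lift.
    by have /rowP/(_ (lift j b)) := MI _ lr; rewrite !mxE.
  have := mul_mx_adj (1%:M : 'M[R]_n); rewrite mul1mx det1 => /matrixP/(_ j r).
  by rewrite !mxE.
rewrite (bigD1 r) //= cofE eqxx mulr1 big1 ?addr0 // => j /negbTE jr.
by rewrite cofE jr mulr0.
Qed.

Definition base_family (i : 'I_26) : monomial3 := basis_monomial i.

(** For c = 6u + j, the [j]-th basis quartic is replaced by the [u]-th other quartic; the 9 * 6
    exchanges match the coefficients in [normal_form]. *)
Definition swap_family (c : 'I_54) (i : 'I_26) : monomial3 :=
  if i == (20 + c %% 6)%N :> nat
  then nth (0, 0, 0)%N other_quartics (c %/ 6)%N
  else base_family i.

Lemma plucker_base (k : closedFieldType) (y : nat -> k) :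
  plucker base_family (quotient_tuple y) = 1.
Proof.
rewrite /plucker -[RHS](det1 k 26); congr (\det _); apply/row_matrixP => i.
by rewrite rowK plucker_row_quotient normal_form_nth row1.
Qed.

(** Only the exchanged row differs from the identity, and its diagonal entry is the coefficient
    [y c]. As the base coordinate is 1, these 54 ratios take arbitrary values. *)
Lemma plucker_swap (k : closedFieldType) (y : nat -> k) c :
  plucker (swap_family c) (quotient_tuple y) = y c.
Proof.
have ltr : (20 + c %% 6 < 26)%N by rewrite (@ltn_add2l 20 _ 6) ltn_mod.
rewrite /plucker (@det_replace_row _ _ _ (Ordinal ltr)) => [|i].
  rewrite mxE plucker_row_quotient /swap_family eqxx mxE /=.
  have ltu : (c %/ 6 < size other_quartics)%N by rewrite ltn_divLR.
  have ou := mem_nth (0, 0, 0)%N ltu.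
  rewrite (negbTE (other_quartics_notin ou)) ou leq_addr /= index_uniq //.
  by rewrite addKn mulnC -divn_eq.
rewrite -val_eqE /= => /negbTE ir.
by rewrite rowK plucker_row_quotient /swap_family ir normal_form_nth row1.
Qed.

Lemma reducible_size26 (k : closedFieldType) :
  reducible (@commuting_nilpotent k 3 26).
Proof.
have [N [c [[a0 ca0] rel]]] := @homogeneous_relation k (26 + 26) 54
  (regular_plucker k base_family)
  (fun i => regular_plucker k (swap_family i)) isT.
(* These parameters violate the relation, so [quotient_tuple y] is the second witness. *)
have [y yc] := box_monomials_independent ca0.
have [v Cv v0] := regular_tuple k 25 (0 : 'I_3).
apply: (@reducible_of_zero_divisors _ _ _ _
  (fun v => (tnth v 0 ^+ 25) 0 ord_max)
  (fun v => \sum_a c a * ((\prod_i plucker (swap_family i) v ^+ a i) *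
    plucker base_family v ^+ (54 * N - \sum_i a i)))
  v (quotient_tuple y)) => //.
- exact/polynomial_mxfunX/polynomial_mxfun_tnth.
- apply: polynomial_fun_sum => a; apply: polynomial_funM.
    exact: polynomial_fun_cst.
  apply: polynomial_funM; last exact/polynomial_funX/polynomial_fun_plucker.
  apply: polynomial_fun_prod => i.
  exact/polynomial_funX/polynomial_fun_plucker.
- move=> w Cw w0; have [x [d pluckE]] := plucker_regular Cw w0.
  (* By homogeneity, replacing every generic minor by the actual one multiplies the whole relation
     by [d ^+ (54 * N)]. *)
  have := congr1 (fun p => meval x p * d ^+ (54 * N)) rel.
  rewrite meval0 mul0r => relx; rewrite -[RHS]relx raddf_sum mulr_suml.
  apply: eq_bigr => a _.
  rewrite /= mevalZ mevalM rmorph_prod rmorphXn /= -!mulrA; congr (_ * _).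
  have -> : \prod_i plucker (swap_family i) w ^+ a i =
      (\prod_i meval x (regular_plucker k (swap_family i) ^+ a i)) *
      d ^+ (\sum_i a i).
    rewrite -prodrXr -big_split; apply: eq_bigr => i _ /=.
    by rewrite pluckE exprMn rmorphXn.
  have le_a : (\sum_(i < 54) a i <= \sum_(i < 54) N)%N.
    by apply: leq_sum => i _; exact: ltnW.
  rewrite sum_nat_const card_ord in le_a.
  have -> : d ^+ (54 * N) = d ^+ (\sum_i a i) * d ^+ (54 * N - \sum_i a i).
    by rewrite -exprD subnKC.
  rewrite pluckE exprMn.
  by rewrite -!mulrA; congr (_ * _); rewrite mulrCA.
- exact: quotient_tuple_commuting.
- apply: contraNneq yc => E; rewrite -[X in _ == X]E; apply/eqP/eq_bigr => a _.
  rewrite plucker_base expr1n mulr1; congr (_ * _).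
  by apply: eq_bigr => i _; rewrite plucker_swap.
Qed.

Theorem corollary3p2p3 (k : closedFieldType) (r : nat) (hr : (2 < r)%N) :
  exists n' : nat,
    [/\ least_reducible_size k r n',
        r = 3%N -> (4 <= n' <= 29)%N &
        (3 < r)%N -> n' = 4%N].
Proof.
pose P n := `[< (0 < n)%N /\ reducible (@commuting_nilpotent k r n) >].
have P4 : (3 < r)%N -> P 4.
  by move=> lt3r; apply/asboolP; split=> //; apply: reducible_size4.
have P26 : r = 3%N -> P 26.
  by move=> r3; apply/asboolP; split=> //; rewrite r3; apply: reducible_size26.
have exP : exists n, P n.
  have [lt3r|] := ltnP 3 r; first by exists 4%N; apply: P4.
  by move=> le_r3; exists 26%N; apply: P26; lia.
case: (ex_minnP exP) => n /asboolP[n0 redn] minn.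
have n4 : (3 < n)%N.
  case: n n0 redn {minn} => // n _ redn; rewrite ltnNge; apply/negP => len3.
  by apply: redn; apply: irreducible_le3.
exists n; split.
- split=> // m m0 redm; apply: minn; exact/asboolP.
(* Minimality against size 26 gives an upper bound below 29. *)
- by move=> /P26/minn ?; lia.
- by move=> /P4/minn ?; lia.
Qed.
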